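(* Let $k>0$ be a real number. For every convex quadrilateral $ABCD$ in the Euclidean plane (degenerate ones allowed, in the sense of the context), let $A_1,B_1,C_1,D_1$ be the points of the segments $AB,BC,CD,DA$ respectively that satisfy $$\frac{|AA_1|}{|A_1B|}=\frac{|BB_1|}{|B_1C|}=\frac{|CC_1|}{|C_1D|}=\frac{|DD_1|}{|D_1A|}=k,$$ and let $KLMN$ be the quadrilateral formed by the straight lines $AB_1$, $BC_1$, $CD_1$, $DA_1$, where $K=AB_1\cap DA_1$, $L=AB_1\cap BC_1$, $M=BC_1\cap CD_1$, $N=CD_1\cap DA_1$. Let $S$ and $s$ be the areas of $ABCD$ and $KLMN$ respectively. Then: (1) For every convex quadrilateral $ABCD$, $$\frac{1}{(k+1)(k^2+k+1)}\,S\ \leq\ s\ \leq\ \frac{1}{2k^2+2k+1}\,S .$$ (2) If $S>0$, then the equality $(k+1)(k^2+k+1)\,s=S$ holds if and only if two of the vertices $A,B,C,D$ coincide. (3) Every convex quadrilateral $ABCD$ with $S>0$ and $(2k^2+2k+1)\,s=S$ belongs to a continuous family of convex quadrilaterals with positive area, all having the same property $(2k^2+2k+1)\,s=S$ (for the same $k$), which contains a parallelogram. That is, there is a continuous map $t\mapsto (A_t,B_t,C_t,D_t)$ from $[0,1]$ to $(\mathbb{R}^2)^4$ such that $(A_0,B_0,C_0,D_0)=(A,B,C,D)$, each $A_tB_tC_tD_t$ is a convex quadrilateral with positive area satisfying $(2k^2+2k+1)\,s=S$, and $A_1B_1C_1D_1$ at time $t=1$ (the vertices of the family, not the division points above) is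 a parallelogram.
   Context: A convex quadrilateral $ABCD$ is an ordered quadruple of points of the Euclidean plane $\mathbb{R}^2$, the vertices taken in cyclic order. Degenerate convex quadrilaterals are allowed: adjacent vertices may coincide and three consecutive vertices may be collinear. For quadrilaterals of positive area this means precisely that the signed areas of the four triangles $ABC$, $BCD$, $CDA$, $DAB$ are all $\geq 0$ or all $\leq 0$, and $S$, the area of the convex hull of $A,B,C,D$, is positive. (Equivalently, after a cyclic relabelling of the vertices and an affine transformation, $A=(0,0)$, $B=(0,1)$, $D=(1,0)$, $C=(a,b)$ with $a\ge 0$, $b\ge 0$, $a+b\ge 1$.) The division points are $A_1=\frac{A+kB}{k+1}$, $B_1=\frac{B+kC}{k+1}$, $C_1=\frac{C+kD}{k+1}$, $D_1=\frac{D+kA}{k+1}$; these formulas also define them when the endpoints of a side coincide. When $S>0$, the four lines $AB_1,BC_1,CD_1,DA_1$ and their intersection points $K,L,M,N$ are well defined, and the quadrilateral $KLMN$ lies inside $ABCD$; $s$ is its area. When $S=0$, the convention is $s=0$ (as $KLMN$ lies inside $ABCD$). A parallelogram here means a non-degenerate one (positive area). *)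

(* Defs.v *)
From HB Require Import structures.
From mathcomp Require Import all_boot all_order all_algebra.
From mathcomp Require Import all_classical all_reals all_analysis.
Import Order.TTheory GRing.Theory Num.Theory.
Import numFieldNormedType.Exports.

Set Implicit Arguments.
Unset Strict Implicit.
Unset Printing Implicit Defensive.

Local Open Scope classical_set_scope.
Local Open Scope ring_scope.

Notation plane R := (R * R)%type (only parsing).
Notation quad R :=
  (plane R * plane R * plane R * plane R)%type (only parsing).

Definition conv_hull (R : realType) (q : quad R) : set (plane R) :=
  let: (A, B, C, D) := q in
  [set P | exists a b c d : R,
    [/\ [/\ 0 <= a, 0 <= b, 0 <= c & 0 <= d],
        a + b + c + d = 1
      & P = a *: A + b *: B + c *: C + d *: D]].

(* The hull is compact, so its Lebesgue measure is finite and [fine] loses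
   nothing.  For vertices in convex position taken in cyclic order this is the
   area of the quadrilateral. *)
Definition area (R : realType) (q : quad R) : R :=
  fine ((@lebesgue_measure R \x @lebesgue_measure R)%E (conv_hull q)).

Definition signed_area (R : realType) (A B C : plane R) : R :=
  ((B.1 - A.1) * (C.2 - A.2) - (B.2 - A.2) * (C.1 - A.1)) / 2.

(* Degenerate quadrilaterals are included: adjacent vertices may coincide and
   consecutive vertices may be collinear.  If [0 < area q], this says that
   A, B, C, D are in convex position in this cyclic order; if [area q = 0],
   all four points are collinear and the condition holds trivially. *)
Definition convex_quad (R : realType) (q : quad R) : Prop :=
  let: (A, B, C, D) := q in
  [/\ 0 <= signed_area A B C, 0 <= signed_area B C D,
      0 <= signed_area C D A & 0 <= signed_area D A B]
  \/
  [/\ signed_area A B C <= 0, signed_area B C D <= 0,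
      signed_area C D A <= 0 & signed_area D A B <= 0].

(* The point X of the segment PQ with |PX| / |XQ| = k, for k > 0. *)
Definition division_point (R : realType) (k : R) (P Q : plane R) : plane R :=
  (k + 1)^-1 *: (P + k *: Q).

Definition line (R : realType) (P Q : plane R) : set (plane R) :=
  [set X | exists t : R, X = P + t *: (Q - P)].

(* Arbitrary unless the lines PQ and UV meet; for convex quadrilaterals of
   positive area all the intersections below are singletons. *)
Definition line_meet (R : realType) (P Q U V : plane R) : plane R :=
  get (line P Q `&` line U V).

Definition inner_quad (R : realType) (k : R) (q : quad R) : quad R :=
  let: (A, B, C, D) := q in
  let A1 := division_point k A B in
  let B1 := division_point k B C in
  let C1 := division_point k C D in
  let D1 := division_point k D A in
  let K := line_meet A B1 D A1 in
  let L := line_meet A B1 B C1 in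
  let M := line_meet B C1 C D1 in
  let N := line_meet C D1 D A1 in
  (K, L, M, N).

(* If [area q = 0], the lines may coincide or be undefined; as KLMN lies inside
   ABCD, its area is then 0 by convention. *)
Definition inner_area (R : realType) (k : R) (q : quad R) : R :=
  if area q == 0 then 0 else area (inner_quad k q).

Definition two_vertices_coincide (R : realType) (q : quad R) : Prop :=
  let: (A, B, C, D) := q in
  A = B \/ A = C \/ A = D \/ B = C \/ B = D \/ C = D.

Definition parallelogram (R : realType) (q : quad R) : Prop :=
  (let: (A, B, C, D) := q in B - A = C - D) /\ 0 < area q.

(* Main.v *)
Require Import Defs.
From HB Require Import structures.
From mathcomp Require Import all_boot all_order all_algebra.
From mathcomp Require Import all_classical all_reals all_analysis.
From mathcomp Require Import measurable_realfun ring lra.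
Import Order.TTheory GRing.Theory Num.Theory.
Import numFieldNormedType.Exports.

Set Implicit Arguments.
Unset Strict Implicit.
Unset Printing Implicit Defensive.

Local Open Scope classical_set_scope.
Local Open Scope ring_scope.

(** The diagonals of a convex quadrilateral of positive area meet in a point X
    and are not parallel, so [p = C - A] and [q = D - B] give an affine frame
    centred at X.  In this frame the whole configuration depends on two numbers
    [u, v] in [[-1, 1]], which say where X divides the diagonals ([kite]).
    The construction of KLMN commutes with affine maps, and relabelling
    A -> B -> C -> D -> A turns the frame by a quarter turn,
    [(p, q, u, v) -> (q, -p, v, -u)].  It is therefore enough to compute one
    vertex of KLMN ([line_meet_kite]) and the area of one triangle KLM
    ([signed_area_inner]).

    With [m = 2k^2 + 2k + 1], [P = (k+1)v + ku] and [Q = kv - (k+1)u], the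
    outcome ([area_ratio]) is

      s / S = 1/m - k^4 (P^2 - Q^2)^2 / (m (m^2 - P^2) (m^2 - Q^2)).

    The upper bound is visible, with equality exactly when [P^2 = Q^2].  This
    condition is homogeneous in [(u, v)], so shrinking [(u, v)] linearly to
    [(0, 0)], which is the case of a parallelogram, stays among the extremal
    quadrilaterals: this is the continuous family.

    For the lower bound put [h = (k+1)(k^2+k+1)].  Since
    [P^2 + Q^2 = m (u^2 + v^2)] and [4k h = m^2 - 1], the difference
    [s/S - 1/h] is a positive multiple of the product of the two factors
    [2m - u^2 - v^2 -/+ (Q^2 - P^2)] ([area_ratio_sub_min]).  They are
    nonnegative on the square, and each of them vanishes at two opposite corners
    and nowhere else ([gap_ge0]); the corners are the quadrilaterals having two
    coinciding vertices.

    The areas are Lebesgue measures of convex hulls, so they have to be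
    identified with the shoelace formula ([area_convex_quad]).  That rests on
    the change of variables for affine maps of the plane ([area_affine_map]),
    which reduces a triangle to half of the unit square, and on cutting a convex
    quadrilateral along a diagonal. *)

(** * Lebesgue measure of the plane under affine maps *)

Section PlaneMeasure.
Context {R : realType}.
Local Notation T := (measurableTypeR R).
Local Notation mu := (@lebesgue_measure R).
Local Notation mu2 := (@lebesgue_measure R \x @lebesgue_measure R)%E.

Lemma measurable_affine1 (a b : R) :
  measurable_fun [set: T] (fun y : T => a * y + b : T).
Proof.
apply: measurable_funD; last exact: measurable_cst.
by apply: measurable_funM => //; exact: measurable_cst.
Qed.

(** Pulling back along [y |-> a y + b] and multiplying by [`|a|] gives a measure
    with the right value on every half-open interval, which determines it. *)
Lemma lebesgue_measure_affine (a b : R) (A : set T) : a != 0 -> measurable A ->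
  mu ((fun y : T => a * y + b : T) @^-1` A) = (`|a|^-1%:E * mu A)%E.
Proof.
move=> a0 mA.
pose f : T -> T := fun y => a * y + b.
have mf : measurable_fun [set: T] f by exact: measurable_affine1.
pose r : {nonneg R} := NngNum (normr_ge0 a).
pose m : {measure set T -> \bar R} := mscale r (pushforward mu f).
suff e : mu A = m mf A.
  rewrite e /m /mscale /pushforward /= muleA -EFinM mulVf ?mul1e//.
  by rewrite normr_eq0.
apply: (lebesgue_measure_unique (mu := m mf)) mA => _ [[x y] _ <-].
rewrite [RHS](_ : _ = (`|a|%:E * mu (f @^-1` `]x, y]))%E)//.
have [a_gt0|a_lt0|/eqP] := ltgtP 0 a; last by rewrite eq_sym (negbTE a0).
  have -> : f @^-1` `]x, y]%classic = `](x - b) / a, (y - b) / a]%classic.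
    apply/seteqP; split => z; rewrite /f /= !in_itv/=.
      by rewrite ltr_pdivrMr// ler_pdivlMr// ltrBlDr lerBrDr (mulrC z).
    by rewrite ltr_pdivrMr// ler_pdivlMr// ltrBlDr lerBrDr (mulrC z).
  rewrite !lebesgue_measure_itv/= !lte_fin ltr_pM2r ?invr_gt0// ltrD2r.
  case: ifP => _; last by rewrite mule0.
  by rewrite gtr0_norm// -!EFinB -EFinM; congr EFin; field.
have -> : f @^-1` `]x, y]%classic = `[(y - b) / a, (x - b) / a[%classic.
  apply/seteqP; split => z; rewrite /f /= !in_itv/=.
    rewrite ler_ndivrMr// ltr_ndivlMr// ltrBlDr lerBrDr (mulrC z).
    by rewrite andbC.
  rewrite ler_ndivrMr// ltr_ndivlMr// ltrBlDr lerBrDr (mulrC z).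
  by rewrite andbC.
rewrite !lebesgue_measure_itv/= !lte_fin ltr_nM2r ?invr_lt0// ltrD2r.
case: ifP => _; last by rewrite mule0.
by rewrite ltr0_norm// -!EFinB -EFinM; congr EFin; field.
Qed.

Definition affine_map (a b e c d f : R) (z : T * T) : T * T :=
  (a * z.1 + b * z.2 + e : T, c * z.1 + d * z.2 + f : T).

Lemma measurable_affine_map (a b e c d f : R) :
  measurable_fun [set: T * T] (affine_map a b e c d f).
Proof.
apply: measurable_fun_pair.
  apply: measurable_funD; last exact: measurable_cst.
  by apply: measurable_funD; apply: measurable_funM;
    [exact: measurable_cst|exact: measurable_fst
    |exact: measurable_cst|exact: measurable_snd].
apply: measurable_funD; last exact: measurable_cst.
by apply: measurable_funD; apply: measurable_funM;
  [exact: measurable_cst|exact: measurable_fst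
  |exact: measurable_cst|exact: measurable_snd].
Qed.

Lemma measurable_affine_preimage (a b e c d f : R) (E : set (T * T)) :
  measurable E -> measurable (affine_map a b e c d f @^-1` E).
Proof.
by move=> mE; rewrite -[X in measurable X]setTI; exact: measurable_affine_map.
Qed.

(** Every vertical section of the preimage is the preimage of a section under an
    affine map of the line, so the one-dimensional case can be integrated. *)
Lemma area_vertical_shear (c d f : R) (E : set (T * T)) : d != 0 -> measurable E ->
  mu2 (affine_map 1 0 0 c d f @^-1` E) = (`|d|^-1%:E * mu2 E)%E.
Proof.
move=> d0 mE; rewrite /product_measure1 -ge0_integralZl//; last first.
  exact: measurable_fun_xsection.
apply: eq_integral => x _ /=.
rewrite -(lebesgue_measure_affine (c * x + f)) //; last first.
  exact: measurable_xsection.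
congr (mu _); apply/seteqP; split=> y; rewrite /= !xsectionP /affine_map/=;
  by rewrite mul1r mul0r !addr0 addrA (addrC (d * y)).
Qed.

Lemma area_swap (E : set (T * T)) : measurable E ->
  mu2 (affine_map 0 1 0 1 0 0 @^-1` E) = mu2 E.
Proof.
move=> mE; pose f : T * T -> T * T := affine_map 0 1 0 1 0 0.
have mf : measurable_fun setT f by exact: measurable_affine_map.
pose m : {measure set (T * T) -> \bar R} := pushforward mu2 f.
suff e : mu2 E = m mf E by rewrite e.
apply: (product_measure_unique (m' := m mf)) mE => A B mA mB.
rewrite [LHS](_ : _ = mu2 (f @^-1` (A `*` B)))//.
have -> : f @^-1` (A `*` B) = B `*` A.
  apply/seteqP; split => -[x y]; rewrite /f /affine_map /= ?(mul1r,mul0r,addr0,add0r).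
    by case.
  by case.
by rewrite product_measure1E// muleC.
Qed.

Lemma affine_map_comp (a b e c d f a' b' e' c' d' f' : R) (E : set (T * T)) :
  affine_map a b e c d f @^-1` (affine_map a' b' e' c' d' f' @^-1` E) =
  affine_map (a' * a + b' * c) (a' * b + b' * d) (a' * e + b' * f + e')
    (c' * a + d' * c) (c' * b + d' * d) (c' * e + d' * f + f') @^-1` E.
Proof.
by apply: eq_set => z; rewrite /affine_map /=; congr (E (_, _)); ring.
Qed.

Lemma area_horizontal_shear (a b e : R) (E : set (T * T)) : a != 0 -> measurable E ->
  mu2 (affine_map a b e 0 1 0 @^-1` E) = (`|a|^-1%:E * mu2 E)%E.
Proof.
move=> a0 mE; rewrite -[LHS](area_swap (E := _ @^-1` _)); last first.
  exact: measurable_affine_preimage.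
rewrite -(area_swap mE) -(area_vertical_shear b e a0); last first.
  exact: measurable_affine_preimage.
by rewrite !affine_map_comp !(mul0r, mul1r, mulr0, mulr1, addr0, add0r).
Qed.

(** An affine map with [d != 0] changes first only the second coordinate and then
    only the first one; swapping the coordinates reduces the remaining case to
    this one. *)
Lemma area_affine_map (a b e c d f : R) (E : set (T * T)) :
  a * d - b * c != 0 -> measurable E ->
  mu2 (affine_map a b e c d f @^-1` E) = (`|a * d - b * c|^-1%:E * mu2 E)%E.
Proof.
have main a' b' e' c' d' f' : d' != 0 -> a' * d' - b' * c' != 0 -> measurable E ->
    mu2 (affine_map a' b' e' c' d' f' @^-1` E) =
    (`|a' * d' - b' * c'|^-1%:E * mu2 E)%E.
  move=> d0 det0 mE.
  have -> : affine_map a' b' e' c' d' f' @^-1` E =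
      affine_map 1 0 0 c' d' f' @^-1`
        (affine_map ((a' * d' - b' * c') / d') (b' / d') (e' - b' * f' / d')
           0 1 0 @^-1` E).
    by rewrite affine_map_comp; apply: eq_set => z; congr (E (_, _)); field.
  rewrite area_vertical_shear//; last exact: measurable_affine_preimage.
  rewrite area_horizontal_shear ?mulf_neq0 ?invr_eq0//.
  rewrite muleA -EFinM normrM normrV ?unitfE//.
  by congr (EFin _ * _)%E; field; rewrite !normr_eq0 d0 det0.
move=> det0 mE; have [d0|d0] := eqVneq d 0; last exact: main.
have c0 : c != 0.
  by apply: contra_neq det0 => ->; rewrite d0 !mulr0 subrr.
have det0' : b * c - a * d != 0 by rewrite -opprB oppr_eq0.
have := main b a e d c f c0 det0' mE; rewrite -opprB normrN => <-.
rewrite -[LHS](area_swap (E := _ @^-1` _)); last first.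
  exact: measurable_affine_preimage.
by rewrite affine_map_comp !(mul0r, mul1r, mulr0, mulr1, addr0, add0r).
Qed.

End PlaneMeasure.

(** * Areas of triangles and of convex quadrilaterals *)

Section TriangleArea.
Context {R : realType}.
Local Notation T := (measurableTypeR R).
Local Notation mu2 := (@lebesgue_measure R \x @lebesgue_measure R)%E.

Definition affine_line (a b c : R) : set (T * T) :=
  [set z | a * z.1 + b * z.2 + c = 0].

(* The first coordinate [- b x + a y] completes the equation of the line to an
   affine bijection that carries the line to the horizontal axis. *)
Let line_preimage (a b c : R) :
  affine_line a b c = affine_map (- b) a 0 a b c @^-1` ([set: T] `*` [set 0]).
Proof. by apply/seteqP; split => z //= -[]. Qed.

Lemma measurable_affine_line (a b c : R) : measurable (affine_line a b c).
Proof.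
by rewrite line_preimage; apply: measurable_affine_preimage; exact: measurableX.
Qed.

Lemma affine_line_null (a b c : R) : (a != 0) || (b != 0) ->
  mu2 (affine_line a b c) = 0%E.
Proof.
move=> ab0; rewrite line_preimage area_affine_map; last exact: measurableX.
  by rewrite product_measure1E//= lebesgue_measure_set1 !mule0.
rewrite mulNr -opprD oppr_eq0 -!expr2 paddr_eq0 ?sqr_ge0// !sqrf_eq0.
by rewrite negb_and orbC.
Qed.

Definition std_triangle : set (T * T) :=
  [set z | [/\ 0 <= z.1 :> R, 0 <= z.2 :> R & z.1 + z.2 <= 1 :> R]].

Lemma measurable_std_triangle : measurable std_triangle.
Proof.
have -> : std_triangle = (`[0, +oo[%classic `*` `[0, +oo[%classic) `&`
    affine_map (-1) (-1) 1 0 0 0 @^-1` (`[0, +oo[%classic `*` [set: T]).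
  apply/seteqP; split => z; rewrite /std_triangle /affine_map /= !in_itv/= !andbT.
    by case=> *; split => //; split => //; lra.
  by case=> -[? ?] [? _]; split => //; lra.
apply: measurableI; first exact: measurableX.
by apply: measurable_affine_preimage; exact: measurableX.
Qed.

(** The unit square is the union of the triangle and its image under the point
    reflection in the centre of the square; they share only the hypotenuse. *)
Lemma area_std_triangle : mu2 std_triangle = (2^-1)%:E.
Proof.
have mS := measurable_std_triangle.
pose S' := affine_map (-1) 0 1 0 (-1) 1 @^-1` std_triangle.
have mS' : measurable S' by exact: measurable_affine_preimage.
have S'E : mu2 S' = mu2 std_triangle.
  have det1 : -1 * -1 - 0 * 0 = 1 :> R by ring.
  by rewrite area_affine_map// det1 ?oner_eq0// normr1 invr1 mul1e.
have U : std_triangle `|` S' = (`[0, 1]%classic `*` `[0, 1]%classic).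
  apply/seteqP; split => z; rewrite /S' /std_triangle /affine_map /= !in_itv/=.
    by case=> -[? ? ?]; split; apply/andP; split; lra.
  case=> /andP[? ?] /andP[? ?]; have [|/ltW] := leP (z.1 + z.2 : R) 1 => ?.
    by left; split.
  by right; split; lra.
have sq : mu2 (`[0, 1]%classic `*` `[0, 1]%classic) = 1%E.
  by rewrite product_measure1E//= lebesgue_measure_itv/= lte_fin ltr01 sube0 mule1.
have I0 : mu2 (std_triangle `&` S') = 0%E.
  apply: (@subset_measure0 _ _ _ _ _ (affine_line 1 1 (-1))).
  - exact: measurableI.
  - exact: measurable_affine_line.
  - move=> z; rewrite /S' /std_triangle /affine_line /affine_map /=.
    by case=> -[? ? ?] [? ? ?]; lra.
  - by apply: affine_line_null; rewrite oner_eq0.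
have fS : (mu2 std_triangle < +oo)%E.
  apply: (@le_lt_trans _ _ (mu2 (`[0, 1]%classic `*` `[0, 1]%classic))).
    by rewrite -U; apply: le_measure; rewrite ?inE//; exact: measurableU.
  by rewrite sq ltry.
have : mu2 (std_triangle `|` S') =
    (mu2 std_triangle + mu2 S' - mu2 (std_triangle `&` S'))%E.
  exact: measureUfinl.
rewrite U sq S'E I0 sube0.
rewrite -(fineK (x := mu2 std_triangle)) ?ge0_fin_numE//.
by rewrite -EFinD => -[e]; congr EFin; lra.
Qed.

End TriangleArea.

Section HullArea.
Context {R : realType}.
Local Notation T := (measurableTypeR R).
Local Notation mu2 := (@lebesgue_measure R \x @lebesgue_measure R)%E.
Implicit Types A B C D P : plane R.

Lemma plane_eqP P Q : P.1 = Q.1 -> P.2 = Q.2 -> P = Q :> plane R.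
Proof. by case: P Q => [? ?] [? ?] /= -> ->. Qed.

Lemma plane_coordE :
  ((forall P Q, (P + Q)%R.1 = (P.1 + Q.1)%R) *
   (forall P Q, (P + Q)%R.2 = (P.2 + Q.2)%R) *
   (forall P, (- P)%R.1 = (- P.1)%R) * (forall P, (- P)%R.2 = (- P.2)%R) *
   (forall (a : R) P, (a *: P)%R.1 = (a * P.1)%R) *
   (forall (a : R) P, (a *: P)%R.2 = (a * P.2)%R))%type.
Proof. by []. Qed.

(* The affine map takes a point to its barycentric coordinates with respect to
   B and C. *)
Let hull3_preimage A B C : signed_area A B C != 0 ->
  let s := (B.1 - A.1) * (C.2 - A.2) - (B.2 - A.2) * (C.1 - A.1) in
  conv_hull (A, B, C, C) =
  affine_map ((C.2 - A.2) / s) (- (C.1 - A.1) / s)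
      ((A.2 * (C.1 - A.1) - A.1 * (C.2 - A.2)) / s)
    (- (B.2 - A.2) / s) ((B.1 - A.1) / s)
      ((A.1 * (B.2 - A.2) - A.2 * (B.1 - A.1)) / s) @^-1` std_triangle.
Proof.
move=> + s; rewrite /signed_area -/s mulf_eq0 invr_eq0 pnatr_eq0 orbF => s0.
apply/seteqP; split => P; rewrite /= /std_triangle /affine_map /=.
  case=> a [b [c [d [[a0 b0 c0 d0] sum1 ->]]]].
  have aE : a = 1 - b - c - d by lra.
  have -> : (C.2 - A.2) / s * (a *: A + b *: B + c *: C + d *: C).1 +
      - (C.1 - A.1) / s * (a *: A + b *: B + c *: C + d *: C).2 +
      (A.2 * (C.1 - A.1) - A.1 * (C.2 - A.2)) / s = b.
    by rewrite !plane_coordE aE /s; field.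
  have -> : - (B.2 - A.2) / s * (a *: A + b *: B + c *: C + d *: C).1 +
      (B.1 - A.1) / s * (a *: A + b *: B + c *: C + d *: C).2 +
      (A.1 * (B.2 - A.2) - A.2 * (B.1 - A.1)) / s = c + d.
    by rewrite !plane_coordE aE /s; field.
  by split => //; lra.
set b := (_ / s * P.1 + _ / s * P.2 + _ / s).
set c := (X in [/\ _, 0 <= X & _]) => -[b0 c0 bc1].
exists (1 - b - c), b, c, 0; split; [split => //|by ring|].
  by rewrite -addrA -opprD subr_ge0.
by apply: plane_eqP; rewrite !plane_coordE /b /c /s; field.
Qed.

Lemma measurable_triangle A B C : signed_area A B C != 0 ->
  measurable (conv_hull (A, B, C, C) : set (T * T)).
Proof.
move=> s0; rewrite (hull3_preimage s0); apply: measurable_affine_preimage.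
exact: measurable_std_triangle.
Qed.

Lemma area_triangle A B C : signed_area A B C != 0 ->
  mu2 (conv_hull (A, B, C, C)) = `|signed_area A B C|%:E.
Proof.
move=> s0; rewrite (hull3_preimage s0).
have s20 : 2 * signed_area A B C != 0 by rewrite mulf_neq0 ?pnatr_eq0.
have sE : (B.1 - A.1) * (C.2 - A.2) - (B.2 - A.2) * (C.1 - A.1) =
  2 * signed_area A B C by rewrite /signed_area; field.
rewrite sE area_affine_map; last exact: measurable_std_triangle.
  rewrite area_std_triangle -EFinM.
  set det := (X in `|X|^-1).
  have -> : det = (2 * signed_area A B C)^-1.
    by rewrite /det -sE; field; rewrite sE.
  by rewrite normfV invrK normrM ger0_norm//; congr EFin; field.
set det := (X in X != 0).
have -> : det = (2 * signed_area A B C)^-1.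
  by rewrite /det -sE; field; rewrite sE.
by rewrite invr_eq0.
Qed.

Let on_line (U V : plane R) : set (T * T) :=
  affine_line (- (V.2 - U.2)) (V.1 - U.1)
    (U.1 * (V.2 - U.2) - U.2 * (V.1 - U.1)).

Lemma on_line_signed_area U V z :
  on_line U V z <-> signed_area U V z = 0.
Proof. by rewrite /on_line /affine_line /signed_area/=; split; lra. Qed.

Lemma line_null (U V : plane R) : U <> V -> mu2 (on_line U V) = 0%E.
Proof.
move=> UV; apply: affine_line_null; rewrite oppr_eq0 -negb_and; apply/negP.
by rewrite !subr_eq0 => /andP[/eqP e2 /eqP e1]; apply: UV; exact: plane_eqP.
Qed.

Lemma signed_area_hull U V A B C D a b c d : a + b + c + d = 1 ->
  signed_area U V (a *: A + b *: B + c *: C + d *: D) =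
  a * signed_area U V A + b * signed_area U V B + c * signed_area U V C +
  d * signed_area U V D.
Proof.
move=> s1; have -> : a = 1 - b - c - d by lra.
by rewrite /signed_area !plane_coordE; field.
Qed.

(** The four signed areas are the coefficients of the affine relation
    [[BCD] A + [DAB] C = [CDA] B + [ABC] D].  Subtracting the multiple of it that
    cancels the coefficient of B keeps the coefficient of D nonnegative. *)
Lemma hull_sub_triangle A B C D a b c d :
  0 < signed_area C D A -> 0 <= signed_area B C D -> 0 <= signed_area D A B ->
  0 <= a -> 0 <= b -> 0 <= c -> 0 <= d -> a + b + c + d = 1 ->
  b * signed_area A B C <= d * signed_area C D A ->
  conv_hull (C, D, A, A) (a *: A + b *: B + c *: C + d *: D).
Proof.
move=> wB wA wC a0 b0 c0 d0 s1 bd.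
pose t := b / signed_area C D A.
have t0 : 0 <= t by rewrite divr_ge0// ltW.
exists (c + t * signed_area D A B), (d - t * signed_area A B C),
  (a + t * signed_area B C D), 0.
have e : signed_area D A B + signed_area B C D - signed_area A B C =
  signed_area C D A by rewrite /signed_area; field.
have t1 : t * signed_area C D A = b by rewrite /t divfK// gt_eqF.
split.
- split => //.
  + by rewrite addr_ge0// mulr_ge0.
  + by rewrite subr_ge0 /t mulrAC ler_pdivrMr.
  + by rewrite addr_ge0// mulr_ge0.
- rewrite -s1 -[in RHS]t1 -e; ring.
- by apply: plane_eqP; rewrite !plane_coordE -t1 /signed_area; field.
Qed.

(* For collinear vertices the hull is a segment.  It is cut out of its line by
   an interval of values of an affine function, which makes it measurable. *)
Let combinations (x y z w : R) : set R :=
  [set r | exists a b c d : R, [/\ [/\ 0 <= a, 0 <= b, 0 <= c & 0 <= d],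
     a + b + c + d = 1 & r = a * x + b * y + c * z + d * w]].

Let is_interval_combinations (x y z w : R) : is_interval (combinations x y z w).
Proof.
move=> _ _ [a [b [c [d [[a0 b0 c0 d0] s1 ->]]]]]
  [a' [b' [c' [d' [[a'0 b'0 c'0 d'0] s'1 ->]]]]] r /andP[].
set p := (X in X <= r); set q := (X in r <= X) => pr rq.
have [pq|pq] := eqVneq p q.
  by exists a, b, c, d; split => //; apply/eqP; rewrite eq_le pr -/p pq rq.
have qp0 : 0 < q - p by rewrite subr_gt0 lt_neqAle pq (le_trans pr).
pose t := (r - p) / (q - p).
have t0 : 0 <= t by rewrite divr_ge0 ?subr_ge0// (le_trans pr).
have t1 : 0 <= 1 - t by rewrite subr_ge0 ler_pdivrMr// mul1r lerD2r.
exists ((1 - t) * a + t * a'), ((1 - t) * b + t * b'),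
  ((1 - t) * c + t * c'), ((1 - t) * d + t * d').
split; first by split; rewrite addr_ge0// mulr_ge0.
  transitivity ((1 - t) * (a + b + c + d) + t * (a' + b' + c' + d')); first by ring.
  by rewrite s1 s'1; ring.
transitivity ((1 - t) * p + t * q); last by rewrite /p /q; ring.
by rewrite /t; field; rewrite gt_eqF.
Qed.

(** In coordinates along and across the line UV the hull is the product of an
    interval and a point. *)
Lemma area_collinear U V A B C D : U <> V ->
  signed_area U V A = 0 -> signed_area U V B = 0 ->
  signed_area U V C = 0 -> signed_area U V D = 0 ->
  mu2 (conv_hull (A, B, C, D)) = 0%E.
Proof.
move=> UV hA hB hC hD.
pose v := V - U.
pose h P := v.1 * P.1 + v.2 * P.2.
pose l P := - v.2 * P.1 + v.1 * P.2 + (U.1 * v.2 - U.2 * v.1).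
have lE P : l P = 2 * signed_area U V P.
  by rewrite /l /signed_area /v !plane_coordE; field.
have v0 : v.1 * v.1 - v.2 * - v.2 != 0.
  rewrite mulrN opprK -!expr2 paddr_eq0 ?sqr_ge0// !sqrf_eq0 !plane_coordE !subr_eq0.
  by apply/negP => /andP[/eqP e1 /eqP e2]; apply: UV; exact: plane_eqP.
have mI : measurable (combinations (h A) (h B) (h C) (h D) : set T).
  exact: is_interval_measurable.
have -> : conv_hull (A, B, C, D) =
    affine_map v.1 v.2 0 (- v.2) v.1 (U.1 * v.2 - U.2 * v.1) @^-1`
    (combinations (h A) (h B) (h C) (h D) `*` [set 0]).
  apply/seteqP; split => P; rewrite /= /affine_map /=.
    case=> a [b [c [d [p s1 PE]]]].
    rewrite -/(l P) lE PE signed_area_hull// hA hB hC hD !mulr0 !addr0 mulr0; split => //.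
    exists a, b, c, d; split => //.
    by rewrite /h !plane_coordE; ring.
  case=> -[a [b [c [d [p s1 PE]]]]] lP.
  exists a, b, c, d; split => //.
  set Q := (X in P = X).
  have lQ : l Q = 0.
    by rewrite lE signed_area_hull// hA hB hC hD !mulr0 !addr0 mulr0.
  have hPQ : h P = h Q.
    by rewrite /h -[LHS]addr0 PE /h /Q !plane_coordE; ring.
  have e : v.1 * (P.2 - Q.2) = v.2 * (P.1 - Q.1).
    by have lP0 : l P = 0 := lP; move: lP0 lQ; rewrite /l; lra.
  have e' : v.1 * (P.1 - Q.1) = - v.2 * (P.2 - Q.2).
    by have := hPQ; rewrite /h; lra.
  apply: plane_eqP; apply/eqP; rewrite -subr_eq0; apply/eqP/(mulfI v0).
    have -> : (v.1 * v.1 - v.2 * - v.2) * (P.1 - Q.1) =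
      v.1 * (v.1 * (P.1 - Q.1)) + v.2 * (v.2 * (P.1 - Q.1)) by ring.
    by rewrite e' -e; ring.
  have -> : (v.1 * v.1 - v.2 * - v.2) * (P.2 - Q.2) =
      v.1 * (v.1 * (P.2 - Q.2)) - v.2 * (- v.2 * (P.2 - Q.2)) by ring.
  by rewrite -e' e; ring.
rewrite area_affine_map//; last exact: measurableX.
by rewrite product_measure1E//= lebesgue_measure_set1 !mule0.
Qed.

Lemma area_degenerate A B C D :
  signed_area A B C = 0 -> signed_area B C D = 0 ->
  signed_area C D A = 0 -> signed_area D A B = 0 ->
  mu2 (conv_hull (A, B, C, D)) = 0%E.
Proof.
move=> wD wA wB wC.
have [eAC|eAC] := pselect (A = C); last first.
  by apply: (area_collinear eAC); move: wD wB; rewrite /signed_area; lra.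
have [AB|AB] := pselect (A = B); last first.
  by apply: (area_collinear AB); move: wD wC; rewrite /signed_area; lra.
have [AD|AD] := pselect (A = D); last first.
  by apply: (area_collinear AD); rewrite -?eAC -?AB /signed_area; lra.
have ne : (0, 0) <> (1, 0) :> plane R.
  by case=> /eqP; rewrite eq_sym oner_eq0.
have eA : A + (1, 0) <> A.
  by move=> /eqP; rewrite -subr_eq0 addrAC subrr add0r => /eqP e; apply: ne.
by apply: (area_collinear eA); rewrite -?eAC -?AB -?AD /signed_area; lra.
Qed.

(* Cutting along the diagonal AC. *)
Let area_split A B C D :
  0 < signed_area A B C -> 0 <= signed_area B C D ->
  0 < signed_area C D A -> 0 <= signed_area D A B ->
  mu2 (conv_hull (A, B, C, D)) = (signed_area A B C + signed_area C D A)%:E.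
Proof.
move=> wD wA wB wC.
have eAC : A <> C.
  by move=> eAC; move: wD; rewrite eAC /signed_area; lra.
have -> : conv_hull (A, B, C, D) =
    conv_hull (A, B, C, C) `|` conv_hull (C, D, A, A).
  apply/seteqP; split => P /=.
    case=> a [b [c [d [[a0 b0 c0 d0] s1 ->]]]].
    have [bd|/ltW bd] := leP (b * signed_area A B C) (d * signed_area C D A).
      by right; exact: hull_sub_triangle.
    left; rewrite (_ : a *: A + _ + _ + _ = c *: C + d *: D + a *: A + b *: B).
      by apply: hull_sub_triangle => //; rewrite -s1; ring.
    by apply: plane_eqP; rewrite !plane_coordE; ring.
  case=> -[a [b [c [d [[a0 b0 c0 d0] s1 ->]]]]].
    exists a, b, (c + d), 0.
    split; [by split => //; exact: addr_ge0|by rewrite -s1; ring|].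
    by apply: plane_eqP; rewrite !plane_coordE; ring.
  exists (c + d), 0, a, b; split; [by split => //; exact: addr_ge0|by rewrite -s1; ring|].
  by apply: plane_eqP; rewrite !plane_coordE; ring.
have neq0_of_gt0 (x : R) : 0 < x -> x != 0 by move=> ?; rewrite gt_eqF.
have mD := measurable_triangle (neq0_of_gt0 _ wD).
have mB := measurable_triangle (neq0_of_gt0 _ wB).
have aD := area_triangle (neq0_of_gt0 _ wD); have aB := area_triangle (neq0_of_gt0 _ wB).
have I0 : mu2 (conv_hull (A, B, C, C) `&` conv_hull (C, D, A, A)) = 0%E.
  apply: (@subset_measure0 _ _ _ _ _ (on_line A C)).
  - exact: measurableI.
  - exact: measurable_affine_line.
  - move=> P [[a [b [c [d [[a0 b0 c0 d0] s1 PE]]]]]].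
    move=> [a' [b' [c' [d' [[a'0 b'0 c'0 d'0] s'1 PE']]]]].
    apply/on_line_signed_area/eqP; rewrite eq_le; apply/andP; split.
      rewrite PE signed_area_hull//.
      have -> : signed_area A C A = 0 by rewrite /signed_area; field.
      have -> : signed_area A C C = 0 by rewrite /signed_area; field.
      have -> : signed_area A C B = - signed_area A B C by rewrite /signed_area; field.
      by rewrite !mulr0 !addr0 add0r mulrN oppr_le0 mulr_ge0// ltW.
    rewrite PE' signed_area_hull//.
    have -> : signed_area A C A = 0 by rewrite /signed_area; field.
    have -> : signed_area A C C = 0 by rewrite /signed_area; field.
    have -> : signed_area A C D = signed_area C D A by rewrite /signed_area; field.
    by rewrite !mulr0 !addr0 add0r mulr_ge0// ltW.
  - exact: line_null.
have : mu2 (conv_hull (A, B, C, C) `|` conv_hull (C, D, A, A)) =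
    (mu2 (conv_hull (A, B, C, C)) + mu2 (conv_hull (C, D, A, A)) -
     mu2 (conv_hull (A, B, C, C) `&` conv_hull (C, D, A, A)))%E.
  by apply: measureUfinl => //; rewrite [X in (X < _)%E]aD ltry.
by rewrite I0 aD aB sube0 !gtr0_norm.
Qed.

(* Here B lies on the segment AC, so the triangle ACD is the whole hull. *)
Let area_one A B C D :
  signed_area A B C = 0 -> 0 <= signed_area B C D ->
  0 < signed_area C D A -> 0 <= signed_area D A B ->
  mu2 (conv_hull (A, B, C, D)) = (signed_area A B C + signed_area C D A)%:E.
Proof.
move=> wD wA wB wC; rewrite wD add0r.
have -> : conv_hull (A, B, C, D) = conv_hull (C, D, A, A).
  apply/seteqP; split => P /=.
    case=> a [b [c [d [[a0 b0 c0 d0] s1 ->]]]].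
    by apply: hull_sub_triangle => //; rewrite wD mulr0 mulr_ge0// ltW.
  case=> [a [b [c [d [[a0 b0 c0 d0] s1 ->]]]]].
  exists (c + d), 0, a, b; split; [by split => //; exact: addr_ge0|by rewrite -s1; ring|].
  by apply: plane_eqP; rewrite !plane_coordE; ring.
by rewrite area_triangle ?gt_eqF// gtr0_norm.
Qed.

Lemma conv_hull_rot A B C D : conv_hull (B, C, D, A) = conv_hull (A, B, C, D).
Proof.
apply/seteqP; split => P /= [a [b [c [d [[a0 b0 c0 d0] s1 ->]]]]].
  exists d, a, b, c; split => //; first by rewrite -s1; ring.
  by apply: plane_eqP; rewrite !plane_coordE; ring.
exists b, c, d, a; split => //; first by rewrite -s1; ring.
by apply: plane_eqP; rewrite !plane_coordE; ring.
Qed.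

Lemma conv_hull_rev A B C D : conv_hull (D, C, B, A) = conv_hull (A, B, C, D).
Proof.
by apply/seteqP; split => P /= [a [b [c [d [[a0 b0 c0 d0] s1 ->]]]]];
  exists d, c, b, a; split => //;
  [rewrite -s1; ring|apply: plane_eqP; rewrite !plane_coordE; ring
  |rewrite -s1; ring|apply: plane_eqP; rewrite !plane_coordE; ring].
Qed.

Let area_pos A B C D :
  0 <= signed_area A B C -> 0 <= signed_area B C D ->
  0 <= signed_area C D A -> 0 <= signed_area D A B ->
  mu2 (conv_hull (A, B, C, D)) = (signed_area A B C + signed_area C D A)%:E.
Proof.
move=> wD wA wB wC.
have e : signed_area D A B + signed_area B C D =
  signed_area A B C + signed_area C D A by rewrite /signed_area; field.
have [wD0|wD0] := eqVneq (signed_area A B C) 0.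
  have [wB0|wB0] := eqVneq (signed_area C D A) 0.
    rewrite wD0 wB0 addr0; apply: area_degenerate => //; lra.
  by apply: area_one => //; rewrite lt_neqAle eq_sym wB0.
have wD1 : 0 < signed_area A B C by rewrite lt_neqAle eq_sym wD0.
have [wB0|wB0] := eqVneq (signed_area C D A) 0.
  by rewrite -2!conv_hull_rot area_one// addrC.
by apply: area_split => //; rewrite lt_neqAle eq_sym wB0.
Qed.

(** Reversing the order of the vertices changes the sign of all signed areas,
    which leaves only positively oriented quadrilaterals. *)
Lemma area_convex_quad A B C D : convex_quad (A, B, C, D) ->
  area (A, B, C, D) = `|signed_area A B C + signed_area C D A|.
Proof.
rewrite /area => -[[wD wA wB wC]|[wD wA wB wC]].
  by rewrite area_pos//= ger0_norm// addr_ge0.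
have rev U V W : signed_area W V U = - signed_area U V W.
  by rewrite /signed_area; field.
have pD : 0 <= signed_area D C B by rewrite rev oppr_ge0.
have pA : 0 <= signed_area C B A by rewrite rev oppr_ge0.
have pB : 0 <= signed_area B A D by rewrite rev oppr_ge0.
have pC : 0 <= signed_area A D C by rewrite rev oppr_ge0.
rewrite -conv_hull_rev (area_pos pD pA pB pC) /=.
rewrite ler0_norm; last by rewrite -oppr_ge0 opprD addr_ge0// oppr_ge0.
by rewrite /signed_area; field.
Qed.

End HullArea.

(** * Quadrilaterals in the frame of their diagonals *)

Section DiagonalFrame.
Context {R : realType}.
Implicit Types (X p q P Q U V Z : plane R) (k u v x y : R).

Definition cross p q : R := p.1 * q.2 - p.2 * q.1.

Definition frame X p q x y : plane R := X + x *: p + y *: q.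

Lemma signed_area_frame X p q x y x' y' x'' y'' :
  signed_area (frame X p q x y) (frame X p q x' y') (frame X p q x'' y'') =
  cross p q * (((x' - x) * (y'' - y) - (y' - y) * (x'' - x)) / 2).
Proof. by rewrite /signed_area /frame /cross !plane_coordE; field. Qed.

Lemma frame_turn X p q x y : frame X q (- p) x y = frame X p q (- y) x.
Proof. by apply: plane_eqP; rewrite /frame !plane_coordE; ring. Qed.

Lemma cross_turn p q : cross q (- p) = cross p q.
Proof. by rewrite /cross !plane_coordE; ring. Qed.

Lemma frame_inj X p q x y x' y' : cross p q != 0 ->
  frame X p q x y = frame X p q x' y' -> x = x' /\ y = y'.
Proof.
move=> c0 e.
have e1 : x * p.1 + y * q.1 = x' * p.1 + y' * q.1.
  by move/(congr1 fst): e; rewrite /frame !plane_coordE; lra.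
have e2 : x * p.2 + y * q.2 = x' * p.2 + y' * q.2.
  by move/(congr1 snd): e; rewrite /frame !plane_coordE; lra.
split; apply: (mulfI c0).
  have -> : cross p q * x =
    (x * p.1 + y * q.1) * q.2 - (x * p.2 + y * q.2) * q.1 by rewrite /cross; ring.
  by rewrite e1 e2 /cross; ring.
have -> : cross p q * y =
  (x * p.2 + y * q.2) * p.1 - (x * p.1 + y * q.1) * p.2 by rewrite /cross; ring.
by rewrite e1 e2 /cross; ring.
Qed.

Definition kite X p q u v : quad R :=
  (frame X p q ((u - 1) / 2) 0, frame X p q 0 ((v - 1) / 2),
   frame X p q ((u + 1) / 2) 0, frame X p q 0 ((v + 1) / 2)).

Lemma convex_kite X p q u v : -1 <= u <= 1 -> -1 <= v <= 1 ->
  convex_quad (kite X p q u v).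
Proof.
move=> /andP[u1 u2] /andP[v1 v2].
rewrite /convex_quad /kite !signed_area_frame.
have [c0|/ltW c0] := leP 0 (cross p q); [left|right].
  by split; apply: mulr_ge0 => //; lra.
by split; apply: mulr_le0_ge0 => //; lra.
Qed.

Lemma area_kite X p q u v : -1 <= u <= 1 -> -1 <= v <= 1 ->
  area (kite X p q u v) = `|cross p q| / 2.
Proof.
move=> hu hv; rewrite area_convex_quad; last exact: convex_kite.
rewrite !signed_area_frame -mulrDr normrM; congr (_ * _).
by rewrite -[RHS]ger0_norm ?invr_ge0//; congr `|_|; field.
Qed.

(** The ratios in which the diagonals cut each other are ratios of signed areas;
    convexity says that they lie between 0 and 1, that is, [u] and [v] between
    -1 and 1. *)
Lemma convex_quad_kite (w : quad R) : convex_quad w -> 0 < area w ->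
  exists X p q u v, [/\ w = kite X p q u v, cross p q != 0,
    -1 <= u <= 1 & -1 <= v <= 1].
Proof.
case: w => [[[A B] C] D] cw.
rewrite area_convex_quad// normr_gt0.
set S := (X in X != 0) => S0.
have SE : S = signed_area B C D + signed_area D A B.
  by rewrite /S /signed_area; field.
have r01 (a b : R) : a + b != 0 ->
    (0 <= a) && (0 <= b) || (a <= 0) && (b <= 0) ->
    -1 <= (a - b) / (a + b) <= 1.
  move=> ab0 sg; have [ab|ab] := ltP 0 (a + b).
    rewrite ler_pdivlMr// ler_pdivrMr//.
    by case/orP: sg => /andP[a0 b0]; apply/andP; split; lra.
  have ab' : a + b < 0 by rewrite lt_neqAle ab0.
  rewrite ler_ndivlMr// ler_ndivrMr//.
  by case/orP: sg => /andP[a0 b0]; apply/andP; split; lra.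
pose g := signed_area D A B; pose d := signed_area A B C.
have alE : signed_area B C D = S - g by rewrite SE addrK.
have beE : signed_area C D A = S - d by rewrite /S /d addrC addKr.
exists (A + (g / S) *: (C - A)), (C - A), (D - B).
exists ((signed_area B C D - signed_area D A B) / S).
exists ((signed_area C D A - signed_area A B C) / S).
split.
- rewrite /kite alE beE -/g -/d.
  have -> : ((S - g - g) / S - 1) / 2 = - (g / S) by field.
  have -> : ((S - g - g) / S + 1) / 2 = 1 - g / S by field.
  have -> : ((S - d - d) / S - 1) / 2 = - (d / S) by field.
  have -> : ((S - d - d) / S + 1) / 2 = 1 - d / S by field.
  have BX : A + (g / S) *: (C - A) - (d / S) *: (D - B) = B.
    apply: plane_eqP; rewrite !plane_coordE; apply: (mulfI S0).
      transitivity (S * A.1 + g * (C.1 - A.1) - d * (D.1 - B.1)); first by field.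
      by rewrite /S /g /d /signed_area; field.
    transitivity (S * A.2 + g * (C.2 - A.2) - d * (D.2 - B.2)); first by field.
    by rewrite /S /g /d /signed_area; field.
  congr (_, _, _, _).
  + by apply: plane_eqP; rewrite /frame !plane_coordE; ring.
  + by rewrite -[LHS]BX /frame scale0r addr0 scaleNr.
  + by apply: plane_eqP; rewrite /frame !plane_coordE; ring.
  + rewrite /frame scale0r addr0 scalerBl scale1r addrA addrAC.
    by rewrite [X in _ = X + _]BX subrKC.
- have -> : cross (C - A) (D - B) = 2 * S.
    by rewrite /cross /S /signed_area !plane_coordE; field.
  by rewrite mulf_neq0.
- rewrite SE; apply: r01; first by rewrite -SE.
  by case: cw => -[wD wA wB wC]; rewrite ?wA ?wB ?wC ?wD ?orbT.
- have SE' : S = signed_area C D A + signed_area A B C by rewrite /S addrC.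
  rewrite SE'; apply: r01; first by rewrite -SE'.
  by case: cw => -[wD wA wB wC]; rewrite ?wA ?wB ?wC ?wD ?orbT.
Qed.

Lemma line_meet_eq P Q U V Z : cross (Q - P) (V - U) != 0 ->
  line P Q Z -> line U V Z -> line_meet P Q U V = Z.
Proof.
move=> c0 lZ mZ; apply: xget_unique; first by split.
move=> Y [[s ->] [t e]]; case: lZ mZ => [s' ->] [t' e'].
have : cross (P + s *: (Q - P) - (P + s' *: (Q - P))) (V - U) = 0.
  by rewrite e e' /cross !plane_coordE; ring.
have -> : cross (P + s *: (Q - P) - (P + s' *: (Q - P))) (V - U) =
  (s - s') * cross (Q - P) (V - U).
  by rewrite /cross !plane_coordE; ring.
by move/eqP; rewrite mulf_eq0 (negbTE c0) orbF subr_eq0 => /eqP ->.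
Qed.

Lemma line_meetC P Q U V : line_meet P Q U V = line_meet U V P Q.
Proof. by rewrite /line_meet setIC. Qed.

(** Up to a positive factor, the cross product of the directions of the lines
    AB_1 and BC_1 in the frame of the diagonals. *)
Definition meet_den k u v : R := 2 * k ^+ 2 + 2 * k + 1 - ((k + 1) * v + k * u).

(** The point L, where the lines AB_1 and BC_1 meet. *)
Definition inner_vertex k X p q u v : plane R :=
  frame X p q (k * (1 + u) * (1 - v) / (2 * meet_den k u v))
    (- ((1 - v) * (1 - v + k * (1 - u))) / (2 * meet_den k u v)).

Lemma meet_den_gt0 k u v : 0 < k -> -1 <= u <= 1 -> -1 <= v <= 1 ->
  0 < meet_den k u v.
Proof.
move=> k0 /andP[_ u1] /andP[_ v1]; rewrite /meet_den.
have : 0 < k ^+ 2 by rewrite exprn_gt0.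
have : 0 <= (k + 1) * (1 - v) by rewrite mulr_ge0//; lra.
have : 0 <= k * (1 - u) by rewrite mulr_ge0//; lra.
lra.
Qed.

Lemma line_meet_kite k X p q u v : 0 < k -> cross p q != 0 ->
  -1 <= u <= 1 -> -1 <= v <= 1 ->
  let: (A, B, C, D) := kite X p q u v in
  line_meet A (division_point k B C) B (division_point k C D) =
  inner_vertex k X p q u v.
Proof.
move=> k0 c0 hu hv; rewrite /kite.
have m0 : meet_den k u v != 0 by rewrite gt_eqF// meet_den_gt0.
have k10 : k + 1 != 0 by rewrite gt_eqF//; lra.
set A := frame X p q _ 0; set B := frame X p q 0 _.
set C := frame X p q _ 0; set D := frame X p q 0 _.
apply: line_meet_eq.
- have -> : cross (division_point k B C - A) (division_point k C D - B) =
      cross p q * meet_den k u v / (2 * (k + 1) ^+ 2).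
    by rewrite /division_point /cross /A /B /C /D /frame /meet_den !plane_coordE; field.
  by rewrite !mulf_neq0// invr_eq0 mulf_neq0// expf_neq0.
- exists ((k + 1) * (1 - v + k * (1 - u)) / meet_den k u v).
  apply: plane_eqP; rewrite /division_point /inner_vertex /A /B /C /frame
    !plane_coordE; move: m0; rewrite /meet_den => m0; by field; rewrite k10.
- exists (k * (k + 1) * (1 - v) / meet_den k u v).
  apply: plane_eqP; rewrite /division_point /inner_vertex /B /C /D /frame
    !plane_coordE; move: m0; rewrite /meet_den => m0; by field; rewrite k10.
Qed.

End DiagonalFrame.

(** * The inner quadrilateral *)

Section InnerQuad.
Context {R : realType}.
Implicit Types (X p q P Q U V Z : plane R) (k u v x y : R) (w : quad R).

Definition relabel w : quad R := let: (A, B, C, D) := w in (B, C, D, A).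

Definition inner_corner k w : plane R := let: (A, B, C, D) := w in
  line_meet A (division_point k B C) B (division_point k C D).

(** All vertices of the inner quadrilateral are the corner L of a relabelled
    quadrilateral. *)
Lemma inner_quadE k w : inner_quad k w =
  (inner_corner k (relabel (relabel (relabel w))), inner_corner k w,
   inner_corner k (relabel w), inner_corner k (relabel (relabel w))).
Proof. by case: w => [[[A B] C] D]; rewrite /inner_quad line_meetC. Qed.

Lemma itv1N u : -1 <= u <= 1 -> -1 <= - u <= 1.
Proof. by rewrite lerN2 lerNl andbC. Qed.

Lemma relabel_kite X p q u v :
  relabel (kite X p q u v) = kite X q (- p) v (- u).
Proof.
by rewrite /relabel /kite !frame_turn; congr (_, _, _, _); congr frame; ring.
Qed.

Lemma inner_corner_kite k X p q u v : 0 < k -> cross p q != 0 ->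
  -1 <= u <= 1 -> -1 <= v <= 1 ->
  inner_corner k (kite X p q u v) = inner_vertex k X p q u v.
Proof. by move=> k0 c0 hu hv; exact: (line_meet_kite X k0 c0 hu hv). Qed.

Lemma inner_vertex_turn k X p q u v :
  inner_vertex k X q (- p) u v =
  frame X p q ((1 - v) * (1 - v + k * (1 - u)) / (2 * meet_den k u v))
    (k * (1 + u) * (1 - v) / (2 * meet_den k u v)).
Proof. by rewrite /inner_vertex frame_turn mulNr opprK. Qed.

Lemma inner_quad_kite k X p q u v : 0 < k -> cross p q != 0 ->
  -1 <= u <= 1 -> -1 <= v <= 1 ->
  inner_quad k (kite X p q u v) =
  (inner_vertex k X (- q) p (- v) u, inner_vertex k X p q u v,
   inner_vertex k X q (- p) v (- u), inner_vertex k X (- p) (- q) (- u) (- v)).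
Proof.
move=> k0 c0 hu hv; have [hNu hNv] := (itv1N hu, itv1N hv).
rewrite inner_quadE !relabel_kite !opprK.
have c1 : cross q (- p) != 0 by rewrite cross_turn.
have c2 : cross (- p) (- q) != 0 by rewrite cross_turn.
have c3 : cross (- q) p != 0 by rewrite -[p]opprK cross_turn.
by rewrite !inner_corner_kite.
Qed.

(** A positive multiple of the difference between the parameters of L and K on
    the line AB_1; that it is nonnegative means that K comes before L. *)
Definition inner_excess k u v : R :=
  (1 - v) * (1 - u + k * (1 + v) + k ^+ 2 * (1 + u)) +
  k * (1 - u) * (1 - u + k * (1 + v)).

Lemma inner_excess_ge0 k u v : 0 < k -> -1 <= u <= 1 -> -1 <= v <= 1 ->
  0 <= inner_excess k u v.
Proof.
move=> k0 /andP[u1 u2] /andP[v1 v2].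
have [k0' u0 u0' v0 v0'] : [/\ 0 <= k, 0 <= 1 - u, 0 <= 1 + u,
  0 <= 1 - v & 0 <= 1 + v] by split; lra.
rewrite /inner_excess; move: u0 u0' v0 v0'.
move: (1 - u) (1 + u) (1 - v) (1 + v) => a b c d a0 b0 c0 d0.
by rewrite !(addr_ge0, mulr_ge0, exprn_ge0).
Qed.

(** Twice the area of KLM is the product of the signed lengths of KL and LM,
    measured by the parameters on the lines AB_1 and BC_1, and of the cross
    product of the directions of these lines. *)
Lemma signed_area_inner k X p q u v : 0 < k -> -1 <= u <= 1 -> -1 <= v <= 1 ->
  signed_area (inner_vertex k X (- q) p (- v) u) (inner_vertex k X p q u v)
    (inner_vertex k X q (- p) v (- u)) =
  cross p q * (inner_excess k u v * inner_excess k v (- u) /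
   (4 * (meet_den k (- v) u * meet_den k u v * meet_den k v (- u)))).
Proof.
move=> k0 hu hv; have [hNu hNv] := (itv1N hu, itv1N hv).
have m1 := meet_den_gt0 k0 hu hv; have m2 := meet_den_gt0 k0 hv hNu.
have m3 := meet_den_gt0 k0 hNv hu.
rewrite (_ : inner_vertex k X (- q) p (- v) u = frame X p q
   (- ((1 - u) * (1 - u + k * (1 + v))) / (2 * meet_den k (- v) u))
   (- (k * (1 - v) * (1 - u)) / (2 * meet_den k (- v) u))); last first.
  rewrite -[X in inner_vertex _ _ _ X]opprK inner_vertex_turn.
  by apply: plane_eqP; rewrite /frame !plane_coordE; field; rewrite gt_eqF.
rewrite inner_vertex_turn signed_area_frame; congr (_ * _).
move: m1 m2 m3; rewrite /inner_excess /meet_den => m1 m2 m3.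
by field; rewrite !gt_eqF.
Qed.

(** The denominators [meet_den] of L and N are [m - slant] and [m + slant],
    with [m = 2k^2 + 2k + 1]. *)
Definition slant k u v := (k + 1) * v + k * u.

Definition area_ratio k u v : R :=
  let m := 2 * k ^+ 2 + 2 * k + 1 in
  let P2 := slant k u v ^+ 2 in let Q2 := slant k v (- u) ^+ 2 in
  (m ^- 1) - k ^+ 4 * (P2 - Q2) ^+ 2 / (m * (m ^+ 2 - P2) * (m ^+ 2 - Q2)).

(** The triangle MNK is the triangle KLM of the frame after a half turn. *)
Lemma inner_quad_shoelace k X p q u v : 0 < k -> -1 <= u <= 1 -> -1 <= v <= 1 ->
  cross p q / 2 * area_ratio k u v =
  signed_area (inner_vertex k X (- q) p (- v) u) (inner_vertex k X p q u v)
    (inner_vertex k X q (- p) v (- u)) +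
  signed_area (inner_vertex k X q (- p) v (- u))
    (inner_vertex k X (- p) (- q) (- u) (- v))
    (inner_vertex k X (- q) p (- v) u).
Proof.
move=> k0 hu hv; have [hNu hNv] := (itv1N hu, itv1N hv).
have -> := @signed_area_inner k X p q u v k0 hu hv.
have := @signed_area_inner k X (- p) (- q) (- u) (- v) k0 hNu hNv.
rewrite !opprK => ->.
have m1 := meet_den_gt0 k0 hu hv; have m2 := meet_den_gt0 k0 hv hNu.
have m3 := meet_den_gt0 k0 hNv hu; have m4 := meet_den_gt0 k0 hNu hNv.
have -> : cross (- p) (- q) = cross p q by rewrite !cross_turn.
rewrite -mulrDr -mulrA; congr (_ * _).
rewrite /area_ratio.
set m := 2 * k ^+ 2 + 2 * k + 1.
have -> : m ^+ 2 - slant k u v ^+ 2 = meet_den k u v * meet_den k (- u) (- v).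
  by rewrite /m /slant /meet_den; ring.
have -> : m ^+ 2 - slant k v (- u) ^+ 2 = meet_den k v (- u) * meet_den k (- v) u.
  by rewrite /m /slant /meet_den; ring.
have m0 : 0 < m.
  by rewrite /m; have : 0 < k ^+ 2 by [rewrite exprn_gt0]; lra.
move: m0 m1 m2 m3 m4; rewrite /m /slant /inner_excess /meet_den => m0 m1 m2 m3 m4.
by field; rewrite !gt_eqF.
Qed.

(** * The two bounds on the ratio of the areas *)

Lemma slant_lt k u v : 0 < k -> -1 <= u <= 1 -> -1 <= v <= 1 ->
  slant k u v ^+ 2 < (2 * k ^+ 2 + 2 * k + 1) ^+ 2.
Proof.
move=> k0 hu hv.
have m1 := meet_den_gt0 k0 hu hv; have m2 := meet_den_gt0 k0 (itv1N hu) (itv1N hv).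
rewrite -subr_gt0 (_ : _ - _ = meet_den k u v * meet_den k (- u) (- v)).
  exact: mulr_gt0.
by rewrite /slant /meet_den; ring.
Qed.

(** One of the two factors that govern the lower bound; the other one is
    [gap k v (- u)]. *)
Definition gap k u v : R :=
  2 * (2 * k ^+ 2 + 2 * k + 1) - (u ^+ 2 + v ^+ 2) -
  (slant k v (- u) ^+ 2 - slant k u v ^+ 2).

(** For given [`|u|] and [`|v|] the worst case is [u v = - `|u| `|v|], and what
    remains is a sum of terms that are nonnegative for [`|u|, `|v|] in [[0, 1]]. *)
Lemma gap_ge0 k u v : 0 < k -> -1 <= u <= 1 -> -1 <= v <= 1 ->
  0 <= gap k u v /\ (gap k u v = 0 -> u ^+ 2 = 1 /\ v ^+ 2 = 1).
Proof.
move=> k0 hu hv; pose n := k * (k + 1).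
have n0 : 0 < n by rewrite mulr_gt0//; lra.
have [a0 a1] : 0 <= `|u| /\ `|u| <= 1 by rewrite ler_norml; split.
have [b0 b1] : 0 <= `|v| /\ `|v| <= 1 by rewrite ler_norml; split.
have uv : - (`|u| * `|v|) <= u * v.
  by have := ler_norm (- (u * v)); rewrite normrN normrM; lra.
rewrite -(real_normK (num_real u)) -(real_normK (num_real v)).
have gE : gap k u v = (2 * k + 2) * ((1 + `|u|) * (1 - `|u|)) +
    4 * n * (`|v| * (1 - `|u|)) + (1 - `|v|) * (2 * k * (2 * k + 1 - `|v|)) +
    4 * n * (u * v + `|u| * `|v|).
  have -> : gap k u v = 4 * n + 2 - (2 * k + 2) * u ^+ 2 + 2 * k * v ^+ 2 +
      4 * n * (u * v) by rewrite /gap /slant /n; ring.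
  by rewrite -(real_normK (num_real u)) -(real_normK (num_real v)) /n; ring.
move: `|u| `|v| gE uv a0 a1 b0 b1 => a b gE uv a0 a1 b0 b1.
have t1 : 0 <= (2 * k + 2) * ((1 + a) * (1 - a)).
  by rewrite !mulr_ge0//; lra.
have t2 : 0 <= 4 * n * (b * (1 - a)).
  by rewrite mulr_ge0 ?mulr_ge0 ?(ltW n0)//; lra.
have t3 : 0 <= (1 - b) * (2 * k * (2 * k + 1 - b)).
  by rewrite mulr_ge0 ?mulr_ge0//; lra.
have t4 : 0 <= 4 * n * (u * v + a * b).
  by rewrite mulr_ge0 ?mulr_ge0 ?(ltW n0)//; lra.
split; first by rewrite gE !addr_ge0.
move=> g0.
have /eqP : (2 * k + 2) * ((1 + a) * (1 - a)) = 0 by lra.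
rewrite !mulf_eq0 [2 * k + 2 == 0]gt_eqF ?[1 + a == 0]gt_eqF ?orFb; [|lra|lra].
move=> /eqP ea.
have /eqP : (1 - b) * (2 * k * (2 * k + 1 - b)) = 0 by lra.
rewrite !mulf_eq0 [k == 0]gt_eqF// [2 * k + 1 - b == 0]gt_eqF; last lra.
rewrite pnatr_eq0 !orbF => /eqP eb.
have -> : a = 1 by lra. have -> : b = 1 by lra.
by rewrite expr1n.
Qed.

(** With [a = m^2 - P^2], [b = m^2 - Q^2] and [P^2 + Q^2 = m (u^2 + v^2)], the
    numerator of the difference is [4 (a b - k h (a - b)^2)], that is
    [(a + b)^2 - m^2 (a - b)^2] because [4k h = m^2 - 1]; this is a difference of
    squares. *)
Lemma area_ratio_sub_min k u v : 0 < k -> -1 <= u <= 1 -> -1 <= v <= 1 ->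
  let m := 2 * k ^+ 2 + 2 * k + 1 in
  let h := (k + 1) * (k ^+ 2 + k + 1) in
  area_ratio k u v - h^-1 = k ^+ 3 * m * (gap k u v * gap k v (- u)) /
   (4 * h * ((m ^+ 2 - slant k u v ^+ 2) * (m ^+ 2 - slant k v (- u) ^+ 2))).
Proof.
move=> k0 hu hv m h.
have P0 := slant_lt k0 hu hv; have Q0 := slant_lt k0 hv (itv1N hu).
have k2 : 0 < k ^+ 2 by rewrite exprn_gt0.
have m0 : 0 < m by rewrite /m; lra.
have h0 : 0 < h by rewrite mulr_gt0//; lra.
have r2 : slant k u v ^+ 2 + slant k v (- u) ^+ 2 = m * (u ^+ 2 + v ^+ 2).
  by rewrite /slant /m; ring.
have -> : gap k u v * gap k v (- u) =
    (2 * m - (u ^+ 2 + v ^+ 2)) ^+ 2 -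
    (slant k v (- u) ^+ 2 - slant k u v ^+ 2) ^+ 2.
  by rewrite /gap /slant -/m; ring.
have -> : u ^+ 2 + v ^+ 2 = (slant k u v ^+ 2 + slant k v (- u) ^+ 2) / m.
  by rewrite r2 mulrC mulKf// gt_eqF.
rewrite /area_ratio -/m; move: P0 Q0; rewrite -/m.
move: (slant k u v ^+ 2) (slant k v (- u) ^+ 2) => P Q P0 Q0 {r2}.
rewrite /h /m in m0 h0 P0 Q0 *.
field; rewrite !gt_eqF ?subr_gt0//; lra.
Qed.

End InnerQuad.

Section Extremes.
Context {R : realType}.
Implicit Types (X p q : plane R) (k u v : R).

Local Notation h k := ((k + 1) * (k ^+ 2 + k + 1)).
Local Notation m k := (2 * k ^+ 2 + 2 * k + 1).

Let h_gt0 k : 0 < k -> 0 < h k.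
Proof.
by move=> k0; have : 0 < k ^+ 2 by [rewrite exprn_gt0]; move=> ?; rewrite mulr_gt0//; lra.
Qed.

Let m_gt0 k : 0 < k -> 0 < m k.
Proof. by move=> k0; have : 0 < k ^+ 2 by [rewrite exprn_gt0]; lra. Qed.

Lemma area_ratio_min k u v : 0 < k -> -1 <= u <= 1 -> -1 <= v <= 1 ->
  (h k)^-1 <= area_ratio k u v ?= iff (u ^+ 2 == 1) && (v ^+ 2 == 1).
Proof.
move=> k0 hu hv; have hNu := itv1N hu.
have [g1 e1] := gap_ge0 k0 hu hv; have [g2 e2] := gap_ge0 k0 hv hNu.
have := area_ratio_sub_min k0 hu hv; rewrite /=.
set den := 4 * h k * _.
set c := k ^+ 3 * m k => e.
have c0 : 0 < c by rewrite mulr_gt0 ?exprn_gt0 ?m_gt0.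
have P0 : 0 < m k ^+ 2 - slant k u v ^+ 2 by rewrite subr_gt0 slant_lt.
have Q0 : 0 < m k ^+ 2 - slant k v (- u) ^+ 2 by rewrite subr_gt0 slant_lt.
have den0 : 0 < den by rewrite mulr_gt0 ?(mulr_gt0 P0 Q0)// mulr_gt0 ?h_gt0.
split.
  rewrite -subr_ge0 e; apply: divr_ge0; last exact: ltW.
  by apply: mulr_ge0; [exact: ltW|exact: mulr_ge0].
rewrite eq_sym -subr_eq0 e mulf_eq0 invr_eq0 (gt_eqF den0) orbF mulf_eq0.
rewrite (gt_eqF c0) mulf_eq0 /=.
apply/idP/andP.
  by case/orP => /eqP; [move/e1|move/e2; rewrite sqrrN] => -[-> ->].
case=> /eqP u2 /eqP v2; rewrite -mulf_eq0.
have -> : gap k u v * gap k v (- u) =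
    (2 * m k - (u ^+ 2 + v ^+ 2)) ^+ 2 -
    ((2 * k + 1) * (u ^+ 2 - v ^+ 2) - 4 * (k * (k + 1)) * (u * v)) ^+ 2.
  by rewrite /gap /slant; ring.
have uv2 : (u * v) ^+ 2 = 1 by rewrite exprMn u2 v2 mulr1.
rewrite u2 v2 subrr mulr0 sub0r sqrrN [X in _ - X]exprMn uv2.
by apply/eqP; ring.
Qed.

Lemma area_ratio_max k u v : 0 < k -> -1 <= u <= 1 -> -1 <= v <= 1 ->
  area_ratio k u v <= (m k)^-1 ?= iff (slant k u v ^+ 2 == slant k v (- u) ^+ 2).
Proof.
move=> k0 hu hv; have P0 := slant_lt k0 hu hv.
have Q0 := slant_lt k0 hv (itv1N hu).
rewrite /area_ratio.
set e := (X in _ - X); have den0 : 0 < m k * (m k ^+ 2 - slant k u v ^+ 2) *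
  (m k ^+ 2 - slant k v (- u) ^+ 2) by rewrite !mulr_gt0 ?m_gt0// subr_gt0.
split.
  rewrite gerBl; apply: divr_ge0; last exact: ltW.
  by rewrite mulr_ge0 ?sqr_ge0// exprn_ge0// ltW.
rewrite -subr_eq0 addrAC subrr add0r oppr_eq0 /e mulf_eq0 invr_eq0 (gt_eqF den0).
by rewrite orbF mulf_eq0 !expf_eq0/= (gt_eqF k0)/= subr_eq0.
Qed.

(** KLMN is again convex, its four signed areas being instances of
    [signed_area_inner] for the turned frames, so the shoelace formula applies. *)
Lemma inner_area_kite k X p q u v : 0 < k -> cross p q != 0 ->
  -1 <= u <= 1 -> -1 <= v <= 1 ->
  inner_area k (kite X p q u v) = area_ratio k u v * area (kite X p q u v).
Proof.
move=> k0 c0 hu hv; have [hNu hNv] := (itv1N hu, itv1N hv).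
have den (a b : R) : -1 <= a <= 1 -> -1 <= b <= 1 -> 0 <= meet_den k a b.
  by move=> ha hb; rewrite ltW// meet_den_gt0.
have exc (a b : R) : -1 <= a <= 1 -> -1 <= b <= 1 -> 0 <= inner_excess k a b.
  exact: inner_excess_ge0.
have orient (x : R) : 0 <= x ->
    (0 <= cross p q -> 0 <= cross p q * x) /\ (cross p q <= 0 -> cross p q * x <= 0).
  by move=> x0; split => ?; [exact: mulr_ge0|exact: mulr_le0_ge0].
have conv : convex_quad (inner_quad k (kite X p q u v)).
  rewrite inner_quad_kite//.
  have e1 := @signed_area_inner R k X p q u v k0 hu hv.
  have e2 := @signed_area_inner R k X q (- p) v (- u) k0 hv hNu.
  have e3 := @signed_area_inner R k X (- p) (- q) (- u) (- v) k0 hNu hNv.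
  have e4 := @signed_area_inner R k X (- q) p (- v) u k0 hNv hu.
  rewrite !opprK in e2 e3 e4; rewrite /convex_quad e1 e2 e3 e4.
  have -> : cross q (- p) = cross p q by exact: cross_turn.
  have -> : cross (- p) (- q) = cross p q by rewrite !cross_turn.
  have -> : cross (- q) p = cross p q by rewrite -[p in LHS]opprK !cross_turn.
  have [cp|/ltW cp] := leP 0 (cross p q); [left|right].
    by split; apply: (orient _ _).1 => //; rewrite divr_ge0 ?mulr_ge0 ?exc ?den.
  by split; apply: (orient _ _).2 => //; rewrite divr_ge0 ?mulr_ge0 ?exc ?den.
have A0 : 0 < area (kite X p q u v).
  by rewrite area_kite// divr_gt0// normr_gt0.
rewrite /inner_area gt_eqF// area_kite//.
move: conv; rewrite inner_quad_kite// => conv.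
rewrite area_convex_quad// -inner_quad_shoelace// !normrM mulrC.
rewrite [`|2^-1|]ger0_norm ?invr_ge0// ger0_norm//.
rewrite (le_trans _ (area_ratio_min k0 hu hv).1)// invr_ge0 ltW//.
exact: h_gt0.
Qed.

Lemma kite_coincide X p q u v : cross p q != 0 ->
  two_vertices_coincide (kite X p q u v) <-> u ^+ 2 = 1 /\ v ^+ 2 = 1.
Proof.
move=> c0; split.
  by case=> [|[|[|[|[|]]]]] /(frame_inj c0)[e1 e2];
    first [exfalso; lra|split; nra].
rewrite /kite => -[/eqP + /eqP]; rewrite !sqrf_eq1.
have h0 : (1 - 1) / 2 = 0 :> R by rewrite subrr mul0r.
have h1 : (-1 + 1) / 2 = 0 :> R by rewrite addNr mul0r.
by move=> /orP[] /eqP -> /orP[] /eqP ->; rewrite ?h0 ?h1 /=; tauto.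
Qed.

Lemma continuous_pair (T U V : topologicalType) (f : T -> U) (g : T -> V) :
  continuous f -> continuous g -> continuous (fun t => (f t, g t)).
Proof. by move=> cf cg t; apply: cvg_pair; [exact: cf|exact: cg]. Qed.

Lemma continuous_frame X p q (x y : R -> R) :
  continuous x -> continuous y -> continuous (fun t => frame X p q (x t) (y t)).
Proof.
move=> cx cy t; apply: cvgD; last by apply: cvgZr_tmp; exact: cy.
by apply: cvgD; [exact: cvg_cst|apply: cvgZr_tmp; exact: cx].
Qed.

Lemma continuous_kite X p q (u v : R -> R) :
  continuous u -> continuous v -> continuous (fun t => kite X p q (u t) (v t)).
Proof.
move=> cu cv.
have shift (s : R) (w : R -> R) : continuous w -> continuous (fun t => (w t + s) / 2).
  move=> cw t; apply: cvgM; last exact: cvg_cst.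
  by apply: cvgD; [exact: cw|exact: cvg_cst].
have c0 : continuous (fun _ : R => 0 : R) by move=> t; exact: cvg_cst.
have cF (x y : R -> R) (cx : continuous x) (cy : continuous y) :=
  @continuous_frame X p q x y cx cy.
have cAB := continuous_pair (cF _ _ (shift (-1) u cu) c0)
  (cF _ _ c0 (shift (-1) v cv)).
have cABC := continuous_pair cAB (cF _ _ (shift 1 u cu) c0).
exact: continuous_pair cABC (cF _ _ c0 (shift 1 v cv)).
Qed.

End Extremes.

Theorem theorem1 (R : realType) (k : R) (k_gt0 : 0 < k) :
  [/\ (forall q : quad R, convex_quad q ->
         1 / ((k + 1) * (k ^+ 2 + k + 1)) * area q <= inner_area k q /\
         inner_area k q <= 1 / (2 * k ^+ 2 + 2 * k + 1) * area q),
      (forall q : quad R, convex_quad q -> 0 < area q ->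
         ((k + 1) * (k ^+ 2 + k + 1) * inner_area k q = area q <->
          two_vertices_coincide q))
    & (forall q : quad R, convex_quad q -> 0 < area q ->
         (2 * k ^+ 2 + 2 * k + 1) * inner_area k q = area q ->
         exists f : R -> quad R,
           [/\ {within `[0, 1], continuous f},
               f 0 = q,
               (forall t : R, 0 <= t -> t <= 1 ->
                  [/\ convex_quad (f t), 0 < area (f t)
                    & (2 * k ^+ 2 + 2 * k + 1) * inner_area k (f t)
                      = area (f t)])
             & parallelogram (f 1)])].
Proof.
have k2_gt0 : 0 < k ^+ 2 by rewrite exprn_gt0.
have h_gt0 : 0 < (k + 1) * (k ^+ 2 + k + 1) by rewrite mulr_gt0//; lra.
have m_gt0 : 0 < 2 * k ^+ 2 + 2 * k + 1 by lra.
have area_ratioE (c r S : R) : 0 < c -> S != 0 -> c * (r * S) = S <-> r == c^-1.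
  move=> c0 S0; split=> [e|/eqP ->]; last by rewrite mulVKf// gt_eqF.
  apply/eqP/(mulfI (lt0r_neq0 c0))/(mulIf S0).
  by rewrite -mulrA e divff ?mul1r// gt_eqF.
split.
- move=> w cw; rewrite !div1r.
  have [w0|w0] := eqVneq (area w) 0.
    by rewrite /inner_area w0 eqxx !mulr0.
  have w_gt0 : 0 < area w by rewrite lt_neqAle eq_sym w0 fine_ge0.
  have [X [p [q [u [v [wE c0 hu hv]]]]]] := convex_quad_kite cw w_gt0.
  rewrite wE inner_area_kite// -wE !ler_pM2r//.
  by split; [exact: (area_ratio_min _ hu hv).1|exact: (area_ratio_max _ hu hv).1].
- move=> w cw w_gt0.
  have [X [p [q [u [v [wE c0 hu hv]]]]]] := convex_quad_kite cw w_gt0.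
  rewrite wE kite_coincide// inner_area_kite// -wE.
  rewrite (area_ratioE _ _ _ h_gt0 (lt0r_neq0 w_gt0)).
  rewrite eq_sym (area_ratio_min k_gt0 hu hv).2.
  by split => [/andP[/eqP ? /eqP ?]|[-> ->]]; rewrite ?eqxx.
- move=> w cw w_gt0.
  have [X [p [q [u [v [wE c0 hu hv]]]]]] := convex_quad_kite cw w_gt0.
  rewrite {1 2}wE inner_area_kite// -wE (area_ratioE _ _ _ m_gt0 (lt0r_neq0 w_gt0)).
  rewrite (area_ratio_max k_gt0 hu hv).2 => /eqP balanced.
  (* Shrinking [(u, v)] to [(0, 0)] keeps [P^2 = Q^2]. *)
  pose f (t : R) := kite X p q ((1 - t) * u) ((1 - t) * v).
  have f0 : f 0 = w by rewrite /f subr0 !mul1r.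
  have fA (t : R) : 0 <= t -> t <= 1 ->
      -1 <= (1 - t) * u <= 1 /\ -1 <= (1 - t) * v <= 1.
    move=> t0 t1; move: hu hv; rewrite -!ler_norml => hu hv.
    by rewrite !normrM ger0_norm ?subr_ge0// !mulr_ile1// ?subr_ge0//; lra.
  have f_gt0 (t : R) : 0 <= t -> t <= 1 -> 0 < area (f t).
    by move=> t0 t1; have [? ?] := fA t t0 t1; rewrite area_kite// divr_gt0// normr_gt0.
  exists f; split => //.
  + apply: continuous_subspaceT; apply: continuous_kite => t.
      by apply: cvgM; [apply: cvgB; [exact: cvg_cst|exact: cvg_id]|exact: cvg_cst].
    by apply: cvgM; [apply: cvgB; [exact: cvg_cst|exact: cvg_id]|exact: cvg_cst].
  + move=> t t0 t1; have [ht1 ht2] := fA t t0 t1.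
    split; [exact: convex_kite|exact: f_gt0|].
    rewrite inner_area_kite// (area_ratioE _ _ _ m_gt0 (lt0r_neq0 (f_gt0 t t0 t1))).
    rewrite (area_ratio_max k_gt0 ht1 ht2).2.
    have -> : slant k ((1 - t) * u) ((1 - t) * v) = (1 - t) * slant k u v.
      by rewrite /slant; ring.
    have -> : slant k ((1 - t) * v) (- ((1 - t) * u)) = (1 - t) * slant k v (- u).
      by rewrite /slant; ring.
    by rewrite !exprMn balanced.
  + split; last exact: f_gt0.
    by rewrite /f /kite; apply: plane_eqP; rewrite /frame !plane_coordE; field.
Qed.
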